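(* Let $f$ be a convex, $L$-smooth, twice differentiable function on $\mathcal{D}\subseteq\mathbb{R}^n$, and let $\lambda>0$. Let $\{\mathbf{x}_k\}_{k\ge 0}$ be the sequence generated by the Constrained Gradient Descent (CGD) method $$\mathbf{x}_{k+1} = \mathbf{x}_k - \alpha\left(\nabla f(\mathbf{x}_k) + 2\lambda H(\mathbf{x}_k)\nabla f(\mathbf{x}_k)\right),\qquad k\ge 0,$$ where $H(\mathbf{x})$ denotes the Hessian of $f$ at $\mathbf{x}$. Then for a constant step-size $\alpha\in\left(0,\frac{2}{L(1+2\lambda L)^2}\right)$, the following holds true: 1. The sequence $\{f(\mathbf{x}_k)\}_{k\ge 0}$ is nonincreasing. In addition, for any $k\ge 0$, $f(\mathbf{x}_{k+1})<f(\mathbf{x}_k)$ unless $\nabla f(\mathbf{x}_k)=\mathbf{0}$. 2. $\nabla f(\mathbf{x}_k)\to \mathbf{0}$ as $k\to\infty$. Furthermore, if $f$ satisfies the PL inequality with constant $\mu>0$, then the CGD method with step-size $\alpha=\frac{1}{L(1+2\lambda L)^2}$ has a global linear convergence rate, $$f(\mathbf{x}_k)-f^* \le \left(1-\frac{\mu}{L(1+2\lambda L)^2}\right)^k\left(f(\mathbf{x}_0)-f^*\right).$$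
   Context: The setting is the problem of finding a minimizer $\mathbf{x}^*=\arg\min_{\mathbf{x}\in\mathcal{D}} f(\mathbf{x})$ of a twice differentiable function $f:\mathcal{D}\to\mathbb{R}$, $\mathcal{D}\subseteq\mathbb{R}^n$, by an iterative method, and $f^*$ denotes the optimal function value. $\|\cdot\|$ is the Euclidean norm. $L$-smooth means that $\nabla f$ is Lipschitz with constant $L$. A function $f:\mathcal{D}\to\mathbb{R}$ satisfies the PL inequality if for some $\mu>0$, $\frac12\|\nabla f(\mathbf{x})\|^2\ge \mu\,(f(\mathbf{x})-f^* )$ for all $\mathbf{x}\in\mathcal{D}$. The CGD iteration is gradient descent with step-size $\alpha$ on the penalized function $f(\mathbf{x})+\lambda\|\nabla f(\mathbf{x})\|^2$, where $\lambda>0$ is the fixed penalty parameter. *)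

(* Defs.v *)
From HB Require Import structures.
From mathcomp Require Import all_boot all_order all_algebra.
From mathcomp Require Import all_classical all_reals all_analysis.
Set Implicit Arguments.
Unset Strict Implicit.
Unset Printing Implicit Defensive.
Import Order.TTheory GRing.Theory Num.Theory.
Import numFieldNormedType.Exports.
Local Open Scope classical_set_scope.
Local Open Scope ring_scope.

(* MathComp functions are total, so a function on a domain D of R^n is given
   by f : 'cV[R]_n -> R together with D : set 'cV[R]_n, and only the values of
   f on D are meant to matter.  Accordingly, differentiability at a point x of
   D is Frechet differentiability along the filter [within D (nbhs x)]: it is
   the usual notion when x is interior to D, and the one-sided notion at
   boundary points belonging to D.  When D is convex with nonempty interior,
   such a derivative is unique. *)

Section Defs.
Context {R : realType} {n : nat}.
Implicit Types (D : set 'cV[R]_n) (f : 'cV[R]_n -> R).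

(* The library norm `|v| on matrices is the sup norm. *)
Definition enorm (v : 'cV[R]_n) : R := Num.sqrt (\sum_i v i 0 ^+ 2).

Definition grad D f (x : 'cV[R]_n) : 'cV[R]_n :=
  \col_j 'd (f : 'cV[R]_n -> R^o) (within D (nbhs x)) (delta_mx j 0).

Definition hess D f (x : 'cV[R]_n) : 'M[R]_n :=
  \matrix_(i, j) 'd (grad D f) (within D (nbhs x)) (delta_mx j 0) i 0.

Definition twice_differentiable_on D f : Prop :=
  (forall x, D x ->
     differentiable (f : 'cV[R]_n -> R^o) (within D (nbhs x))) /\
  (forall x, D x -> differentiable (grad D f) (within D (nbhs x))).

Definition smooth_on D f (L : R) : Prop :=
  forall x y, D x -> D y ->
    enorm (grad D f x - grad D f y) <= L * enorm (x - y).

Definition PL_on D f (fstar mu : R) : Prop :=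
  forall x, D x -> mu * (f x - fstar) <= 2^-1 * enorm (grad D f x) ^+ 2.

(* The iteration is unprojected; it makes sense only as long as the iterates
   stay in D, where f, its gradient and its Hessian are defined. *)
Definition CGD D f (lambda alpha : R) (x : nat -> 'cV[R]_n) : Prop :=
  (forall k, D (x k)) /\
  (forall k, x k.+1 = x k - alpha *:
     (grad D f (x k) + (2 * lambda) *: (hess D f (x k) *m grad D f (x k)))).

End Defs.

(* Main.v *)
(** Write g for the gradient and H for the Hessian at the current point.  The
    step is x' = x - alpha w with w = g + 2 lambda H g.  Monotonicity and
    Lipschitz continuity of the gradient pass to the limit in difference
    quotients, so z . Hz >= 0 and |Hz| <= L |z| for every z; hence
    g . w >= |g|^2 and |w| <= (1 + 2 lambda L) |g|, and the descent inequality
    f(x') <= f(x) - alpha g . w + (L/2) alpha^2 |w|^2 gives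
    f(x') <= f(x) - alpha (1 - alpha L (1 + 2 lambda L)^2 / 2) |g|^2.
    Since f is bounded below, the decrements tend to 0, and so does g; under the
    PL inequality the same estimate contracts the optimality gap.

    At a boundary point x of D, the difference quotients are taken between two
    feasible points x + tu and x + tv: as D has interior points, the differences
    u - v cover every direction up to a positive factor. *)
Require Import Defs.
From HB Require Import structures.
From mathcomp Require Import all_boot all_order all_algebra.
From mathcomp Require Import all_classical all_reals all_analysis.
From mathcomp Require Import ring lra.
Set Implicit Arguments.
Unset Strict Implicit.
Import Order.TTheory GRing.Theory Num.Theory.
Import numFieldNormedType.Exports.
Local Open Scope classical_set_scope.
Local Open Scope ring_scope.

(** * Directional derivatives along rays that stay in the domain *)

Lemma cvg_ray (R : realType) (V : normedModType R) (x v : V) :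
  x + t *: v @[t --> 0^'+] --> x.
Proof.
rewrite -[X in _ --> X]addr0 -[X in _ --> _ + X](scale0r v).
apply: cvgD; first exact: cvg_cst.
apply: cvgZr_tmp; apply: cvg_at_right_filter; exact: cvg_id.
Qed.

(** On a ray inside [D] the remainder of the first-order expansion is o(t), so it vanishes after
    division by t. *)
Lemma cvg_directional_diff (R : realType) (V W : normedModType R) (D : set V)
    (F : V -> W) (x v : V) :
  D x -> differentiable F (within D (nbhs x)) ->
  (\forall t \near 0^'+, D (x + t *: v)) ->
  t^-1 *: (F (x + t *: v) - F x) @[t --> 0^'+] --> 'd F (within D (nbhs x)) v.
Proof.
move=> Dx /diffE dF Dv.
have PF : ProperFilter (within D (nbhs x)).
  by apply: within_nbhs_proper; exact: subset_closure.
(* [diffE] expands around the limit of the filter, which has to be identified with [x]. *)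
have lx : lim (within D (nbhs x)) = x.
  apply: (@cvg_lim _ _ _ (within D (nbhs x)) _ id) => //.
  exact: cvg_within.
rewrite lx in dF.
set d := @diff _ _ _ _ _ _ in dF *.
have {}dF (e : R) : 0 < e -> \forall y \near within D (nbhs x),
    `|F y - (F x + d (y - x))| <= e * `|y - x|.
  by have /eqaddoP := funext dF; apply.
have cx := @cvg_ray _ _ x v.
apply/cvgrPdist_le => e e0.
(* The tolerance e / (1 + |v|) makes the final error at most e and also covers v = 0. *)
have v1 : 0 < 1 + `|v| by rewrite ltr_wpDr.
have /cx ne := dF (e / (1 + `|v|)) ltac:(by rewrite divr_gt0).
near=> t.
have t0 : 0 < t by near: t; exact: nbhs_right_gt.
have Dt : D (x + t *: v) by near: t.
have : D (x + t *: v) -> `|F (x + t *: v) - (F x + d (x + t *: v - x))| <=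
   e / (1 + `|v|) * `|x + t *: v - x| by near: t.
move=> /(_ Dt).
have -> : x + t *: v - x = t *: v by rewrite addrC addKr.
rewrite linearZ/= normrZ (gtr0_norm t0) => le_t.
rewrite distrC.
have -> : t^-1 *: (F (x + t *: v) - F x) - d v =
    t^-1 *: (F (x + t *: v) - (F x + t *: d v)).
  by rewrite opprD addrA [in RHS]scalerBr scalerA mulVf ?scale1r ?gt_eqF.
rewrite normrZ gtr0_norm ?invr_gt0// ler_pdivrMl//.
apply: (le_trans le_t); rewrite mulrCA ler_pM2l//.
by rewrite -mulrA ger_pMr// mulrC ler_pdivrMr// mul1r lerDr.
Unshelve. all: by end_near.
Qed.

Lemma cvg_directional_diffB (R : realType) (V W : normedModType R) (D : set V)
    (F : V -> W) (x u v : V) :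
  D x -> differentiable F (within D (nbhs x)) ->
  (\forall t \near 0^'+, D (x + t *: u)) ->
  (\forall t \near 0^'+, D (x + t *: v)) ->
  t^-1 *: (F (x + t *: u) - F (x + t *: v)) @[t --> 0^'+]
    --> 'd F (within D (nbhs x)) (u - v).
Proof.
move=> Dx dF Du Dv; rewrite linearB.
have -> : (fun t : R => t^-1 *: (F (x + t *: u) - F (x + t *: v))) =
    (fun t => t^-1 *: (F (x + t *: u) - F x)) -
    (fun t => t^-1 *: (F (x + t *: v) - F x)).
  apply/funext => t; rewrite !fctE -scalerBr.
  by rewrite opprB addrA subrK.
by apply: cvgB; exact: cvg_directional_diff.
Qed.

(** * Euclidean inner product *)

Section DotProduct.
Context {R : realType} {n : nat}.
Implicit Types (a s : R) (u v w : 'cV[R]_n).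

Definition dot u v : R := \sum_i u i 0 * v i 0.

Lemma dotC u v : dot u v = dot v u.
Proof. by apply: eq_bigr => i _; rewrite mulrC. Qed.

Lemma dotDl u v w : dot (u + v) w = dot u w + dot v w.
Proof. by rewrite -big_split; apply: eq_bigr => i _; rewrite mxE mulrDl. Qed.

Lemma dotZl a u v : dot (a *: u) v = a * dot u v.
Proof. by rewrite mulr_sumr; apply: eq_bigr => i _; rewrite mxE mulrA. Qed.

Lemma dotDr u v w : dot u (v + w) = dot u v + dot u w.
Proof. by rewrite dotC dotDl !(dotC u). Qed.

Lemma dotZr a u v : dot u (a *: v) = a * dot u v.
Proof. by rewrite dotC dotZl dotC. Qed.

Lemma dotNl u v : dot (- u) v = - dot u v.
Proof. by rewrite -scaleN1r dotZl mulN1r. Qed.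

Lemma dotNr u v : dot u (- v) = - dot u v.
Proof. by rewrite dotC dotNl dotC. Qed.

Definition dotE := (dotDl, dotDr, dotNl, dotNr, dotZl, dotZr).

Lemma dot_ge0 u : 0 <= dot u u.
Proof. by apply: sumr_ge0 => i _; rewrite -expr2 sqr_ge0. Qed.

Lemma sqr_coord_le_dot u i : u i 0 ^+ 2 <= dot u u.
Proof.
rewrite /dot (bigD1 i)//= -expr2 lerDl.
by apply: sumr_ge0 => j _; rewrite -expr2 sqr_ge0.
Qed.

Lemma dot_gt0 u : u <> 0 -> 0 < dot u u.
Proof.
move=> u0; rewrite lt_neqAle dot_ge0 andbT eq_sym; apply/eqP => uu0; apply: u0.
apply/colP => i; rewrite mxE; apply/eqP; rewrite -sqrf_eq0.
by rewrite eq_le sqr_ge0 andbT -uu0 sqr_coord_le_dot.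
Qed.

Lemma sqr_enorm u : enorm u ^+ 2 = dot u u.
Proof.
rewrite /enorm; under eq_bigr do rewrite expr2.
by rewrite sqr_sqrtr// dot_ge0.
Qed.

Lemma enorm_le_dot s u v :
  0 <= s -> enorm u <= s * enorm v -> dot u u <= s ^+ 2 * dot v v.
Proof.
move=> s0 uv; rewrite -!sqr_enorm -exprMn; apply: lerXn2r => //.
- exact: sqrtr_ge0.
- by rewrite nnegrE mulr_ge0// sqrtr_ge0.
Qed.

(** A substitute for Cauchy-Schwarz: |u - s v|^2 >= 0 gives 2s u.v <= |u|^2 + s^2 |v|^2 <= 2 s^2
    |v|^2. *)
Lemma dot_le_of_sqr s u v :
  0 < s -> dot u u <= s ^+ 2 * dot v v -> dot u v <= s * dot v v.
Proof.
move=> s0 uv; have := dot_ge0 (u - s *: v); rewrite !dotE (dotC v u) => H.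
rewrite -(ler_pM2l s0); nra.
Qed.

Lemma cvg_dot {T : Type} {F : set_system T} {FF : Filter F}
    (p q : T -> 'cV[R]_n) u v :
  p t @[t --> F] --> u -> q t @[t --> F] --> v ->
  dot (p t) (q t) @[t --> F] --> dot u v.
Proof.
move=> pu qv; rewrite /dot; apply: cvg_big => [|i _]; first exact: add_continuous.
have c w : {for w, continuous (fun M : 'cV[R]_n => M i 0)}.
  exact: coord_continuous.
apply: cvgM; first exact: (cvg_comp _ _ pu (c u)).
exact: (cvg_comp _ _ qv (c v)).
Qed.

(** The topology comes from the sup norm, and each squared coordinate is at most [dot u u]. *)
Lemma cvg0_of_dot (u : nat -> 'cV[R]_n) :
  dot (u k) (u k) @[k --> \oo] --> 0 -> u k @[k --> \oo] --> (0 : 'cV[R]_n).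
Proof.
move=> /cvgr0Pnorm_le uu; apply/cvgr0Pnorm_le => e e0.
have := uu (e ^+ 2) ltac:(by rewrite exprn_gt0).
apply: filterS => k; rewrite ger0_norm ?dot_ge0// => uke.
rewrite /Num.norm/= mx_normrE; apply/bigmax_leP; split => [|[i j] _]/=; first exact: ltW.
rewrite (ord1 j) -[leRHS]ger0_norm ?(ltW e0)// -ler_sqr ?nnegrE// !real_normK ?num_real//.
exact: le_trans (sqr_coord_le_dot _ _) uke.
Qed.

(** When [d] is the differential of [f], the column on the right is [grad]; [linear_mulmx] plays the
    same role for [hess]. *)
Lemma linear_dot (d : {linear 'cV[R]_n -> R^o}) v :
  d v = dot (\col_j d (delta_mx j 0)) v.
Proof.
rewrite {1}[v]matrix_sum_delta linear_sum; apply: eq_bigr => i _.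
by rewrite big_ord1 linearZ/= mxE mulrC.
Qed.

Lemma linear_mulmx (d : {linear 'cV[R]_n -> 'cV[R]_n}) v :
  d v = (\matrix_(i, j) d (delta_mx j 0) i 0) *m v.
Proof.
rewrite {1}[v]matrix_sum_delta linear_sum; apply/colP => i; rewrite summxE mxE.
by apply: eq_bigr => j _; rewrite big_ord1 linearZ/= !mxE mulrC.
Qed.

End DotProduct.

(** * Feasible directions and first-order convexity *)

Section ConvexDomain.
Context {R : realType} {n : nat}.
Variables (D : set 'cV[R]_n) (f : 'cV[R]_n -> R).
Hypothesis D_convex : convex_set (D : set (convex_lmodType 'cV[R]_n)).

Lemma convex_segment x v (t : R) :
  D x -> D (x + v) -> 0 <= t -> t <= 1 -> D (x + t *: v).
Proof.
move=> Dx Dv t0 t1.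
have := D_convex (x := x + v) (y := x) (Itv01 t0 t1) (mem_set Dv) (mem_set Dx).
move=> /set_mem; congr D.
rewrite /conv/= /unstable.onem scalerBl scale1r scalerDr.
by rewrite addrC -addrA addKr.
Qed.

Lemma near_convex_ray x v :
  D x -> D (x + v) -> \forall t \near 0^'+, D (x + t *: v).
Proof.
move=> Dx Dv; near=> t; apply: convex_segment => //.
by near: t; exact: nbhs_right_le.
Unshelve. all: by end_near.
Qed.

Lemma convex_direction_diff x w : D x -> interior D !=set0 ->
  exists s u v, [/\ 0 < s, D (x + u), D (x + v) & u - v = s *: w].
Proof.
move=> Dx [z Dz].
(* Moving from the interior point [z] along [w] stays in [D] for small s; the directions from [x] to
   z + s w and to z then differ by s w. *)
have [s [s0 Ds]] : exists s, 0 < s /\ D (z + s *: w).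
  have Dw : \forall s \near 0^'+, D (z + s *: w) by exact: (@cvg_ray _ _ z w).
  have [s []] := filter_ex (filterI (nbhs_right_gt (0 : R)) Dw).
  by exists s.
exists s, (z + s *: w - x), (z - x); split => //.
- by rewrite addrC subrK.
- by rewrite addrC subrK; exact: interior_subset.
- by rewrite opprB addrA subrK addrC addKr.
Qed.

Hypothesis f_convex : convex_function D f.
Hypothesis f_diff : forall x, D x ->
  differentiable (f : 'cV[R]_n -> R^o) (within D (nbhs x)).

(** Convexity bounds the difference quotients along the segment by f y - f x for 0 < t <= 1; let t
    tend to 0. *)
Lemma convex_first_order x y : D x -> D y -> f x + dot (grad D f x) (y - x) <= f y.
Proof.
move=> Dx Dy; rewrite -lerBrDl.
have Dxy : D (x + (y - x)) by rewrite addrC subrK.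
have /= := cvg_directional_diff Dx (f_diff Dx) (near_convex_ray Dx Dxy).
rewrite linear_dot => /cvgr_to_le; apply.
near=> t.
have t0 : 0 < t by near: t; exact: nbhs_right_gt.
have t1 : t <= 1 by near: t; exact: nbhs_right_le.
rewrite ler_pdivrMl//.
have le_f : f (t *: y + (1 - t) *: x) <= t * f y + (1 - t) * f x.
  have := f_convex (Itv01 (ltW t0) t1) (mem_set Dy) (mem_set Dx).
  by rewrite [X in _ <= X]convRE.
have -> : x + t *: (y - x) = t *: y + (1 - t) *: x.
  by rewrite scalerBl scale1r scalerBr addrCA.
apply: le_trans (lerB le_f (lexx _)) _.
by rewrite le_eqVlt; apply/orP; left; apply/eqP; ring.
Unshelve. all: by end_near.
Qed.

Hypothesis grad_diff : forall x, D x ->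
  differentiable (grad D f) (within D (nbhs x)).

Lemma cvg_grad_quotient x u v : D x -> D (x + u) -> D (x + v) ->
  t^-1 *: (grad D f (x + t *: u) - grad D f (x + t *: v)) @[t --> 0^'+]
    --> hess D f x *m (u - v).
Proof.
move=> Dx Du Dv.
rewrite -linear_mulmx; apply: cvg_directional_diffB => //.
- exact: grad_diff.
- exact: near_convex_ray.
- exact: near_convex_ray.
Qed.

End ConvexDomain.

(** * Descent inequality and Hessian bounds *)

Section SmoothConvexGradient.
Context {R : realType} {n : nat}.
Variables (D : set 'cV[R]_n) (f : 'cV[R]_n -> R) (L : R).
(** Abstract gradient and Hessian, known only through the first-order, Lipschitz and quotient
    hypotheses below. *)
Variables (G : 'cV[R]_n -> 'cV[R]_n) (H : 'cV[R]_n -> 'M[R]_n).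
Hypothesis D_convex : convex_set (D : set (convex_lmodType 'cV[R]_n)).
Hypothesis D_interior : interior D !=set0.
Hypothesis L_gt0 : 0 < L.
Hypothesis G_first_order : forall x y, D x -> D y ->
  f x + dot (G x) (y - x) <= f y.
Hypothesis G_lipschitz : forall x y, D x -> D y ->
  dot (G x - G y) (G x - G y) <= L ^+ 2 * dot (x - y) (x - y).
Hypothesis G_quotient : forall x u v, D x -> D (x + u) -> D (x + v) ->
  t^-1 *: (G (x + t *: u) - G (x + t *: v)) @[t --> 0^'+] --> H x *m (u - v).

(** Add the first-order inequalities at x and at y. *)
Lemma grad_monotone x y :
  D x -> D y -> 0 <= dot (G x - G y) (x - y).
Proof.
move=> Dx Dy.
have := G_first_order Dx Dy; have := G_first_order Dy Dx.
by rewrite !dotE; lra.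
Qed.

(* Summing the first-order inequalities over N equal pieces of the segment
   overshoots the sharp quadratic bound by a factor 1 + 1/N only. *)
Lemma descent_subdivision x v (N m : nat) : D x -> D (x + v) -> (m <= N.+1)%N ->
  f (x + (m%:R / N.+1%:R) *: v) <= f x + m%:R / N.+1%:R * dot (G x) v
    + L * dot v v * (m%:R * m.+1%:R / (2 * N.+1%:R ^+ 2)).
Proof.
move=> Dx Dv; elim: m => [|m IHm] mN.
  by rewrite !mul0r scale0r mulr0 !addr0.
have N0 : 0 < N.+1%:R :> R by rewrite ltr0n.
have Dy k : (k <= N.+1)%N -> D (x + (k%:R / N.+1%:R) *: v).
  move=> kN; apply: (convex_segment D_convex) => //.
  by rewrite ler_pdivrMr// mul1r ler_nat.
have {}IHm := IHm (ltnW mN).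
set y := x + _ in IHm.
set y' := x + _.
have yy' : y - y' = - (N.+1%:R^-1) *: v.
  rewrite /y /y' opprD addrACA subrr add0r -scalerBl; congr (_ *: _).
  by rewrite -natr1; field; exact: lt0r_neq0.
(* Taking the tangent at the far end [y'] bounds f y' from above: f y' <= f y + G y' . v / (N+1). *)
have := G_first_order (Dy _ mN) (Dy _ (ltnW mN)); rewrite -/y -/y' yy' => le_f.
(* [y'] lies at distance (m+1)/(N+1) |v| from [x]; these Lipschitz errors add up to the triangular
   number in the bound. *)
have : dot (G y' - G x) v <= L * (m.+1%:R / N.+1%:R) * dot v v.
  apply: dot_le_of_sqr; first by rewrite mulr_gt0// divr_gt0// ltr0n.
  apply: le_trans (G_lipschitz (Dy _ mN) Dx) _.
  by rewrite addrAC subrr add0r !dotE exprMn expr2 !mulrA.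
rewrite !dotE in le_f * => le_b.
have {}le_b : N.+1%:R^-1 * (dot (G y') v - dot (G x) v)
    <= N.+1%:R^-1 * (L * (m.+1%:R / N.+1%:R) * dot v v).
  by rewrite ler_pM2l// invr_gt0.
rewrite -![m.+2%:R]natr1 -![m.+1%:R]natr1 in le_b IHm *.
move: (N.+1%:R) N0 (dot (G x) v) (dot (G y') v) (dot v v) le_b le_f IHm.
move: (f y) (f y') (m%:R : R) => fy fy' M K N0 a b c le_b le_f IHm.
have -> : f x + (M + 1) / K * a + L * c * ((M + 1) * (M + 1 + 1) / (2 * K ^+ 2))
  = f x + M / K * a + L * c * (M * (M + 1) / (2 * K ^+ 2))
    + K^-1 * a + K^-1 * (L * ((M + 1) / K) * c).
  by field; exact: lt0r_neq0.
by lra.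
Qed.

(** Using all N+1 pieces gives the error factor (N+2)/(N+1) = 1 + [harmonic N], which tends to 1;
    this limit replaces integrating the gradient along the segment. *)
Lemma descent x v : D x -> D (x + v) ->
  f (x + v) <= f x + dot (G x) v + L / 2 * dot v v.
Proof.
move=> Dx Dv.
pose b : nat -> R := fun N => f x + dot (G x) v + L / 2 * dot v v * (1 + harmonic N).
have cb : b N @[N --> \oo] --> f x + dot (G x) v + L / 2 * dot v v * (1 + 0).
  apply: cvgD; first exact: cvg_cst.
  apply: cvgM; first exact: cvg_cst.
  by apply: cvgD; [exact: cvg_cst | exact: cvg_harmonic].
rewrite addr0 mulr1 in cb; apply: (cvgr_to_ge cb).
near=> N.
have := descent_subdivision Dx Dv (leqnn N.+1).
have N0 : N.+1%:R != 0 :> R by rewrite pnatr_eq0.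
rewrite divff// scale1r mul1r => /le_trans; apply.
rewrite le_eqVlt; apply/orP; left; apply/eqP; rewrite /b /harmonic/= -[N.+2%:R]natr1.
by field.
Unshelve. all: by end_near.
Qed.

Lemma hess_psd x w : D x -> 0 <= dot (H x *m w) w.
Proof.
move=> Dx; have [s [u [v [s0 Du Dv uv]]]] := convex_direction_diff w Dx D_interior.
(* Both sides scale by s^2 > 0, so the feasible difference u - v can stand for [w]. *)
suff : 0 <= dot (H x *m (u - v)) (u - v).
  by rewrite uv -scalemxAr !dotE !pmulr_rge0.
apply: (cvgr_to_ge (cvg_dot (G_quotient Dx Du Dv) (cvg_cst (u - v)))).
near=> t.
have t0 : 0 < t by near: t; exact: nbhs_right_gt.
have Du' : D (x + t *: u) by near: t; exact: (near_convex_ray D_convex).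
have Dv' : D (x + t *: v) by near: t; exact: (near_convex_ray D_convex).
have := grad_monotone Du' Dv'.
rewrite opprD addrACA subrr add0r -scalerBr dotZl dotZr !pmulr_rge0//.
by rewrite invr_gt0.
Unshelve. all: by end_near.
Qed.

Lemma hess_bounded x w : D x ->
  dot (H x *m w) (H x *m w) <= L ^+ 2 * dot w w.
Proof.
move=> Dx; have [s [u [v [s0 Du Dv uv]]]] := convex_direction_diff w Dx D_interior.
suff : dot (H x *m (u - v)) (H x *m (u - v))
    <= L ^+ 2 * dot (u - v) (u - v).
  by rewrite uv -scalemxAr !dotE !(mulrCA (L ^+ 2)) !ler_pM2l.
have q := G_quotient Dx Du Dv.
apply: (cvgr_to_le (cvg_dot q q)).
near=> t.
have t0 : 0 < t by near: t; exact: nbhs_right_gt.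
have Du' : D (x + t *: u) by near: t; exact: (near_convex_ray D_convex).
have Dv' : D (x + t *: v) by near: t; exact: (near_convex_ray D_convex).
have := G_lipschitz Du' Dv'.
rewrite opprD addrACA subrr add0r -scalerBr !(dotZl, dotZr).
by rewrite !(mulrCA (L ^+ 2)) !ler_pdivrMl.
Unshelve. all: by end_near.
Qed.

Lemma CGD_descent lambda alpha x : 0 < lambda -> 0 <= alpha -> D x ->
  let x' := x - alpha *: (G x + (2 * lambda) *: (H x *m G x)) in D x' ->
  f x' <= f x - alpha * (1 - alpha * (L * (1 + 2 * lambda * L) ^+ 2) / 2)
              * dot (G x) (G x).
Proof.
move=> lambda_gt0 a0 Dx x' Dx'.
apply: le_trans (descent Dx Dx') _.
have hg := hess_psd (G x) Dx.
have hh := hess_bounded (G x) Dx.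
move: (G x) (H x *m G x) hg hh => g h hg hh.
have hgL := dot_le_of_sqr L_gt0 hh.
rewrite !dotE (dotC g h).
have gg := dot_ge0 g.
set a := dot h g in hg hgL *; set b := dot h h in hh *; set c := dot g g in gg hh hgL *.
(* The left side is |g + 2 lambda h|^2; the cross term is bounded by [hgL] and the square term by
   [hh]. *)
have w2 : c + 2 * (2 * lambda) * a + (2 * lambda) ^+ 2 * b
    <= (1 + 2 * lambda * L) ^+ 2 * c.
  have : (2 * lambda) ^+ 2 * b <= (2 * lambda) ^+ 2 * (L ^+ 2 * c).
    by rewrite ler_wpM2l// sqr_ge0.
  have : lambda * a <= lambda * (L * c) by rewrite ler_pM2l.
  by lra.
have : L * alpha ^+ 2 * (c + 2 * (2 * lambda) * a + (2 * lambda) ^+ 2 * b)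
    <= L * alpha ^+ 2 * ((1 + 2 * lambda * L) ^+ 2 * c).
  by rewrite ler_wpM2l// mulr_ge0// ?sqr_ge0// ltW.
(* Positive semidefiniteness lets the curvature term of g . w be dropped, leaving |g|^2. *)
have : 0 <= alpha * (lambda * a) by rewrite !mulr_ge0// ltW.
by lra.
Qed.

End SmoothConvexGradient.

(** * Convergence of the iterates and the linear rate *)

Unset Implicit Arguments.
Set Strict Implicit.

Theorem theorem1 (R : realType) (n : nat) (D : set 'cV[R]_n)
    (f : 'cV[R]_n -> R) (L lambda : R) (xstar : 'cV[R]_n)
    (D_convex : convex_set (D : set (convex_lmodType 'cV[R]_n)))
    (D_interior : interior D !=set0)
    (f_convex : convex_function D f)
    (f_twice_diff : twice_differentiable_on D f)
    (L_gt0 : 0 < L)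
    (f_smooth : smooth_on D f L)
    (xstar_D : D xstar)
    (xstar_min : forall y : 'cV[R]_n, D y -> f xstar <= f y)
    (lambda_gt0 : 0 < lambda) :
  (forall (alpha : R) (x : nat -> 'cV[R]_n),
     0 < alpha -> alpha < 2 / (L * (1 + 2 * lambda * L) ^+ 2) ->
     CGD D f lambda alpha x ->
     [/\ nonincreasing_seq (fun k => f (x k)),
         (forall k : nat, grad D f (x k) <> 0 -> f (x k.+1) < f (x k)) &
         (fun k => grad D f (x k)) @ \oo --> (0 : 'cV[R]_n)]) /\
  (forall mu : R, 0 < mu -> PL_on D f (f xstar) mu ->
     forall x : nat -> 'cV[R]_n,
     CGD D f lambda (1 / (L * (1 + 2 * lambda * L) ^+ 2)) x ->
     forall k : nat,
       f (x k) - f xstar <=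
       (1 - mu / (L * (1 + 2 * lambda * L) ^+ 2)) ^+ k * (f (x 0%N) - f xstar)).
Proof.
have [f_diff grad_diff] := f_twice_diff.
(* One estimate for both parts, valid for every nonnegative step-size. *)
have step alpha x : 0 <= alpha -> CGD D f lambda alpha x -> forall k,
    f (x k.+1) <= f (x k)
      - alpha * (1 - alpha * (L * (1 + 2 * lambda * L) ^+ 2) / 2)
        * enorm (grad D f (x k)) ^+ 2.
  move=> a0 [Dx xS] k; have DSk := Dx k.+1.
  rewrite sqr_enorm; rewrite xS in DSk *.
  have Dk := Dx k.
  apply: (CGD_descent D_convex D_interior L_gt0) Dk DSk => // [y z|y z|y u v].
  - exact: convex_first_order.
  - by move=> Dy Dz; apply: enorm_le_dot; [exact: ltW | exact: f_smooth].
  - exact: cvg_grad_quotient.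
have M_gt0 : 0 < L * (1 + 2 * lambda * L) ^+ 2.
  by rewrite mulr_gt0// exprn_gt0// addr_gt0// !mulr_gt0.
move: (L * _) M_gt0 step => M M_gt0 step; split.
  move=> alpha x a0 aM xCGD.
  set c := alpha * (1 - alpha * M / 2).
  (* Positivity of the decrease coefficient is exactly where alpha < 2 / M enters. *)
  have c_gt0 : 0 < c.
    by rewrite mulr_gt0// subr_gt0 ltr_pdivrMr// mul1r -ltr_pdivlMr.
  have le_f k : c * enorm (grad D f (x k)) ^+ 2 <= f (x k) - f (x k.+1).
    by rewrite lerBrDr addrC -lerBrDr; exact: step (ltW a0) xCGD k.
  have f_noninc : nonincreasing_seq (fun k => f (x k)).
    apply/nonincreasing_seqP => k; rewrite -subr_ge0.
    by apply: le_trans (le_f k); rewrite mulr_ge0 ?sqr_ge0// ltW.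
  split => // [k gk|].
    rewrite -subr_gt0; apply: lt_le_trans (le_f k).
    by rewrite mulr_gt0// sqr_enorm dot_gt0.
  have f_cvg : cvgn (fun k => f (x k)).
    apply: nonincreasing_is_cvgn => //.
    by exists (f xstar) => _ [k _ <-]; apply: xstar_min; case: xCGD.
  (* A convergent sequence and its shift have the same limit. *)
  have df0 : f (x k) - f (x k.+1) @[k --> \oo] --> (0 : R).
    rewrite -(subrr (limn (fun k => f (x k)))); apply: cvgB; first exact: f_cvg.
    by rewrite (cvg_shiftS (fun k => f (x k))).
  apply: cvg0_of_dot.
  have cdf0 : c^-1 * (f (x k) - f (x k.+1)) @[k --> \oo] --> (0 : R).
    by rewrite -(mulr0 c^-1); apply: cvgM => //; exact: cvg_cst.
  (* The squared gradient norm lies between 0 and the decrement divided by [c]. *)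
  apply: (squeeze_cvgr _ (cvg_cst (0 : R)) cdf0); near=> k.
  by rewrite dot_ge0/= ler_pdivlMl// -sqr_enorm le_f.
move=> mu mu0 PL x xCGD k.
have Dx j : D (x j) by case: xCGD.
set q := 1 - mu / M.
have a0 : 0 <= 1 / M by rewrite divr_ge0// ltW.
have contr j : f (x j.+1) - f xstar <= q * (f (x j) - f xstar).
  have := step _ _ a0 xCGD j.
  (* At alpha = 1 / M the coefficient is 1/(2M), and PL turns |g|^2 / (2M) into at least mu / M
     times the gap. *)
  have -> : 1 / M * (1 - 1 / M * M / 2) = M^-1 * 2^-1 by field; exact: lt0r_neq0.
  have : M^-1 * (mu * (f (x j) - f xstar))
      <= M^-1 * (2^-1 * enorm (grad D f (x j)) ^+ 2).
    by rewrite ler_pM2l ?invr_gt0// PL.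
  rewrite /q; move: (enorm _ ^+ 2) => e.
  rewrite -[_ * _ * e]mulrA mulrBl mul1r -[mu / M * _]mulrA.
  rewrite (mulrCA mu); move: (M^-1 * _) (M^-1 * _) => A B; lra.
have gap_ge0 j : 0 <= f (x j) - f xstar by rewrite subr_ge0 xstar_min.
(* The induction multiplies an inequality by [q], so the sign of [q] matters. *)
have [q0|q0] := leP 0 q.
  elim: k => [|k IHk]; first by rewrite expr0 mul1r.
  apply: le_trans (contr k) _.
  by rewrite exprS -mulrA ler_wpM2l.
(* If q < 0, the contraction forces every optimality gap to vanish. *)
have gap0 j : f (x j) - f xstar = 0.
  apply/eqP; rewrite eq_le gap_ge0 andbT -(nmulr_rge0 _ q0).
  exact: le_trans (gap_ge0 j.+1) (contr j).
by rewrite !gap0 mulr0.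
Unshelve. all: by end_near.
Qed.
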